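(* Assume that either (a) $d=2$ and $p=\infty$, or (b) $d>2$ is an integer and $p\in(p_*(d),\infty]$. Let $\Omega\subseteq\mathbb{R}^d\times\mathbb{R}^d$ be a measurable set with $\mathcal{L}^{2d}(\Omega)>0$. Then there exists $f\in L^2(\mathbb{R}^d)$ such that $W_{\mathrm{BJ}}f\notin L^p(\Omega)$; in other words, the supremum \[ \sup_{f\in L^2(\mathbb{R}^d)\setminus\{0\}}\frac{\|W_{\mathrm{BJ}}f\|_{L^p(\Omega)}}{\|f\|_{L^2(\mathbb{R}^d)}^2}=\infty \] is attained.
   Context: Functions in $L^2(\mathbb{R}^d)$ are complex-valued, and $\mathcal{L}^{2d}$ is Lebesgue measure on $\mathbb{R}^{2d}$. For $f\in L^2(\mathbb{R}^d)$, $\tau\in(0,1)$ and $z=(x,\xi)\in\mathbb{R}^d\times\mathbb{R}^d$, the $\tau$-Wigner distribution is \[ W_\tau f(z)=\int_{\mathbb{R}^d}e^{-2\pi i\xi\cdot y}f(x+\tau y)\,\overline{f(x-(1-\tau)y)}\,dy, \] and the Born--Jordan distribution is $W_{\mathrm{BJ}}f(z)=\int_0^1 W_\tau f(z)\,d\tau$ (the integral in $\tau$ converges absolutely for a.e. $z$ and $W_{\mathrm{BJ}}f\in L^2(\mathbb{R}^{2d})$). The critical exponent for $d\ge3$ is $p_*(d)=\left(\frac12-\frac1d\right)^{-1}=\frac{2d}{d-2}$. The norm $\|W_{\mathrm{BJ}}f\|_{L^p(\Omega)}$ is understood to be $\infty$ if $W_{\mathrm{BJ}}f\notin L^p(\Omega)$.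 *)

(* Defs.v *)
From HB Require Import structures.
From mathcomp Require Import all_boot all_order all_algebra.
From mathcomp Require Import all_classical all_reals all_analysis.
From mathcomp Require Import complex.

Set Implicit Arguments.
Unset Strict Implicit.
Unset Printing Implicit Defensive.
Import Order.TTheory GRing.Theory Num.Theory.
Import numFieldNormedType.Exports.

Local Open Scope classical_set_scope.
Local Open Scope ring_scope.
Local Open Scope complex_scope.

Definition rV_display : measure_display -> measure_display.
Proof. exact. Qed.

Section measurable_rV.
Context d (T : measurableType d) (n : nat).

Let coord (i : 'I_n) (x : 'rV[T]_n) : T := x ord0 i.

Let rV_set0 : g_sigma_preimage coord set0.
Proof. exact: sigma_algebra0. Qed.

Let rV_setC A : g_sigma_preimage coord A -> g_sigma_preimage coord (~` A).
Proof. exact: sigma_algebraC. Qed.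

Let rV_bigcup (F : (set 'rV[T]_n)^nat) :
  (forall i, g_sigma_preimage coord (F i)) ->
  g_sigma_preimage coord (\bigcup_i (F i)).
Proof. exact: sigma_algebra_bigcup. Qed.

HB.instance Definition _ := @isMeasurable.Build (rV_display d)
  'rV[T]_n (g_sigma_preimage coord) rV_set0 rV_setC rV_bigcup.

End measurable_rV.

Lemma measurable_coord d (T : measurableType d) n (i : 'I_n) :
  measurable_fun [set: 'rV[T]_n] (fun x => x ord0 i).
Proof.
move=> _ Y mY; rewrite setTI; apply: sub_sigma_algebra => /=.
rewrite -bigcup_seq/=; exists i => /=; first by rewrite mem_index_enum.
by exists Y => //; rewrite setTI.
Qed.

Lemma measurable_fun_rVP d1 d2 (T1 : measurableType d1) (T2 : measurableType d2)
    n (f : T1 -> 'rV[T2]_n) :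
  measurable_fun [set: T1] f <->
  forall i, measurable_fun [set: T1] (fun x => f x ord0 i).
Proof.
split=> [mf i|mf].
  exact: (measurableT_comp (@measurable_coord _ T2 n i) mf).
move=> _ A; rewrite setTI; move: A.
pose G := [set A | measurable (f @^-1` A)].
suff : @measurable _ 'rV[T2]_n `<=` G by [].
apply: smallest_sub; first split; rewrite /G /=.
- by rewrite preimage_set0.
- by move=> A mA; rewrite setTD preimage_setC; exact: measurableC.
- by move=> F mF; rewrite preimage_bigcup; exact: bigcupT_measurable.
- case: n => [|n] in f mf G *; first by rewrite big_ord0.
  rewrite -bigcup_mkord_ord; apply: bigcup_sub => i Ii A [B mB <-].
  by rewrite /G/= setTI -[_ @^-1` _]setTI; exact: (mf (inord i)).
Qed.


Definition cons_rV (T : Type) n (x : T * 'rV[T]_n) : 'rV[T]_n.+1 :=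
  row_mx (const_mx x.1 : 'rV_1) x.2.

Lemma cons_rV0 (T : Type) n (x : T * 'rV[T]_n) : cons_rV x ord0 ord0 = x.1.
Proof.
transitivity (cons_rV x ord0 (@lshift 1 n ord0)); last first.
  by rewrite /cons_rV (@row_mxEl _ 1 1 n) mxE.
by congr (cons_rV x _ _); exact: val_inj.
Qed.

Lemma cons_rVS (T : Type) n (x : T * 'rV[T]_n) (i : 'I_n) :
  cons_rV x ord0 (lift ord0 i) = x.2 ord0 i.
Proof.
transitivity (cons_rV x ord0 (rshift 1 i)); last first.
  by rewrite /cons_rV (@row_mxEr _ 1 1 n).
by congr (cons_rV x _ _); exact: val_inj.
Qed.

Definition uncons_rV (T : Type) n (x : 'rV[T]_n.+1) : T * 'rV[T]_n :=
  (x ord0 ord0, \row_i x ord0 (lift ord0 i)).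

Lemma cons_rVK (T : Type) n : cancel (@cons_rV T n) (@uncons_rV T n).
Proof.
move=> [a v]; rewrite /uncons_rV cons_rV0; congr pair.
by apply/rowP => i; rewrite mxE cons_rVS.
Qed.

Lemma uncons_rVK (T : Type) n : cancel (@uncons_rV T n) (@cons_rV T n).
Proof.
move=> x; apply/rowP => i.
by case: (unliftP ord0 i) => [j ->|->]; rewrite ?cons_rVS ?cons_rV0 ?mxE.
Qed.

Lemma measurable_cons_rV d (T : measurableType d) n :
  measurable_fun [set: T * 'rV[T]_n] (@cons_rV T n).
Proof.
apply/measurable_fun_rVP => i.
case: (unliftP ord0 i) => [j ->|->].
  rewrite (_ : (fun x => _) = (fun v : 'rV[T]_n => v ord0 j) \o snd).
    exact: measurableT_comp (@measurable_coord _ T n j) measurable_snd.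
  by apply/funext => x; exact: cons_rVS.
rewrite (_ : (fun x => _) = fst); first exact: measurable_fst.
by apply/funext => x; exact: cons_rV0.
Qed.

Lemma measurable_uncons_rV d (T : measurableType d) n :
  measurable_fun [set: 'rV[T]_n.+1] (@uncons_rV T n).
Proof.
apply: measurable_fun_pair; first exact: measurable_coord.
apply/measurable_fun_rVP => i.
rewrite (_ : (fun x => _) = (fun v : 'rV[T]_n.+1 => v ord0 (lift ord0 i))).
  exact: measurable_coord.
by apply/funext => x; rewrite mxE.
Qed.

Lemma product_sigma_finite d1 d2 (T1 : measurableType d1)
    (T2 : measurableType d2) (R : realType)
    (m1 : {sigma_finite_measure set T1 -> \bar R})
    (m2 : {sigma_finite_measure set T2 -> \bar R}) :
  sigma_finite setT (m1 \x m2)%E.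
Proof.
have /sigma_finiteP[F [TF ndF Foo]] := sigma_finiteT m1.
have /sigma_finiteP[G [TG ndG Goo]] := sigma_finiteT m2.
exists (fun n => F n `*` G n).
  rewrite -setXTT TF TG predeqE => -[x y]; split.
    move=> [/= [n _ Fnx] [k _ Gky]]; exists (maxn n k) => //; split.
    - by move: x Fnx; exact/subsetPset/ndF/leq_maxl.
    - by move: y Gky; exact/subsetPset/ndG/leq_maxr.
  by move=> [n _ []/= ? ?]; split; exists n.
move=> k; have [? ?] := Foo k; have [? ?] := Goo k.
split; first exact: measurableX.
by rewrite product_measure1E// lte_mul_pinfty// ge0_fin_numE.
Qed.

Section lebesgue_rV_rec.
Context (R : realType) (n : nat).
Variable m : {sigma_finite_measure set 'rV[R]_n -> \bar R}.

Definition lebesgue_rV_rec : set 'rV[R]_n.+1 -> \bar R :=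
  pushforward (lebesgue_measure \x m)%E (@cons_rV R n).

Let lebesgue_rV_rec0 : lebesgue_rV_rec set0 = 0%E.
Proof. by rewrite /lebesgue_rV_rec /pushforward preimage_set0 measure0. Qed.

Let lebesgue_rV_rec_ge0 A : (0 <= lebesgue_rV_rec A)%E.
Proof. by rewrite /lebesgue_rV_rec /pushforward measure_ge0. Qed.

Let lebesgue_rV_rec_sigma_additive : semi_sigma_additive lebesgue_rV_rec.
Proof.
have mc (A : set 'rV[R]_n.+1) : measurable A ->
    measurable (@cons_rV R n @^-1` A).
  by move=> mA; rewrite -[X in measurable X]setTI; exact: measurable_cons_rV.
move=> F mF tF mUF; rewrite /lebesgue_rV_rec /pushforward preimage_bigcup.
apply: measure_semi_sigma_additive.
- by move=> k; exact: mc.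
- apply/trivIsetP => /= i j _ _ ij; rewrite -preimage_setI.
  by move/trivIsetP : tF => /(_ _ _ _ _ ij) ->//; rewrite preimage_set0.
- by rewrite -preimage_bigcup; exact: mc.
Qed.

HB.instance Definition _ := isMeasure.Build _ _ _ lebesgue_rV_rec
  lebesgue_rV_rec0 lebesgue_rV_rec_ge0 lebesgue_rV_rec_sigma_additive.

Let lebesgue_rV_rec_sigma_finite : sigma_finite setT lebesgue_rV_rec.
Proof.
have [F TF Foo] := product_sigma_finite lebesgue_measure m.
exists (fun k => @uncons_rV R n @^-1` F k).
  by rewrite -preimage_bigcup -TF preimage_setT.
move=> k; have [mF Fk] := Foo k; split.
  by rewrite -[_ @^-1` _]setTI; exact: measurable_uncons_rV.
rewrite /lebesgue_rV_rec /pushforward -comp_preimage.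
rewrite (_ : _ \o _ = id)//; apply/funext => x; exact: cons_rVK.
Qed.

HB.instance Definition _ := Measure_isSigmaFinite.Build _ _ _ lebesgue_rV_rec
  lebesgue_rV_rec_sigma_finite.

End lebesgue_rV_rec.

Fixpoint lebesgue_rV (R : realType) (n : nat) :
    {sigma_finite_measure set 'rV[R]_n -> \bar R} :=
  if n is n'.+1 then lebesgue_rV_rec (lebesgue_rV R n') else \d_(0 : 'rV[R]_0).

Lemma lebesgue_rV_box (R : realType) n (A : 'I_n -> set R) :
  (forall i, measurable (A i)) ->
  lebesgue_rV R n [set x | forall i, A i (x ord0 i)] =
  (\prod_(i < n) lebesgue_measure (A i))%E.
Proof.
elim: n A => [|n IH] A mA.
  rewrite big_ord0 /= diracE mem_set//; by case.
have mB : measurable [set x : 'rV[R]_n | forall i, A (lift ord0 i) (x ord0 i)].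
  rewrite (_ : [set _ | _] = \bigcap_(i in [set: 'I_n])
      ((fun x : 'rV[R]_n => x ord0 i) @^-1` A (lift ord0 i))).
    apply: fin_bigcap_measurable => // i _; rewrite -[_ @^-1` _]setTI.
    exact: measurable_coord.
  by apply/seteqP; split=> x /= h i; [move=> _; exact: h|exact: h].
rewrite big_ord_recl -IH// -product_measure1E//=.
rewrite /lebesgue_rV_rec /pushforward; congr (_ _).
apply/seteqP; split=> [[a v]/= h|[a v] /= [h0 h] i].
  split=> [|i]; first by have := h ord0; rewrite cons_rV0.
  by have := h (lift ord0 i); rewrite cons_rVS.
by case: (unliftP ord0 i) => [j ->|->]; rewrite ?cons_rVS ?cons_rV0//.
exact: (mA ord0).
Qed.

Section phase_space.
Context (R : realType) (d : nat).

Definition lebesgue_phase : set ('rV[R]_d * 'rV[R]_d) -> \bar R :=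
  (lebesgue_rV R d \x lebesgue_rV R d)%E.

HB.instance Definition _ := Measure.on lebesgue_phase.

(* The Caratheodory-measurable sets of the outer measure induced by the Borel
   measure [lebesgue_phase] are the Lebesgue measurable subsets of R^d x R^d. *)
Definition completed_lebesgue_phase :
    {measure set (caratheodory_type (lebesgue_phase^*)%mu) -> \bar R} :=
  @completed_measure_extension _ _ _ lebesgue_phase.

End phase_space.
Arguments lebesgue_phase R d : clear implicits.

Section complex_functions.
Context d (T : measurableType d) (R : realType).
Variable mu : {measure set T -> \bar R}.
Implicit Types (D : set T) (g : T -> R[i]).

(* A real or imaginary part that is not integrable contributes 0. *)
Definition Cintegral D g : R[i] :=
  (\int[mu]_(x in D) complex.Re (g x)) +i* (\int[mu]_(x in D) complex.Im (g x)).

Definition CLnorm (p : \bar R) D g : \bar R :=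
  Lnorm mu p ((fun x => (Normc.normc (g x))%:E) \_ D).

Definition in_CLp (p : \bar R) D g : Prop :=
  [/\ measurable_fun D (fun x => complex.Re (g x)),
      measurable_fun D (fun x => complex.Im (g x)) &
      (CLnorm p D g < +oo)%E].

End complex_functions.

Section wigner.
Context (R : realType) (d : nat).
Implicit Types (f : 'rV[R]_d -> R[i]) (z : 'rV[R]_d * 'rV[R]_d).

Definition dotrV (x y : 'rV[R]_d) : R := \sum_(i < d) x ord0 i * y ord0 i.

Definition expi (t : R) : R[i] := cos t +i* sin t.

Definition wigner (tau : R) f z : R[i] :=
  Cintegral (lebesgue_rV R d) setT (fun y =>
    expi (- (2 * pi * dotrV z.2 y)) *
    f (z.1 + tau *: y) * conjc (f (z.1 - (1 - tau) *: y))).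

Definition born_jordan f z : R[i] :=
  Cintegral lebesgue_measure `]0, 1[ (fun tau => wigner tau f z).

(* Functions rather than classes: every class has a Borel representative, and
   [born_jordan f] does not depend on the representative. *)
Definition L2 : set ('rV[R]_d -> R[i]) :=
  [set f | in_CLp (lebesgue_rV R d) 2%:E setT f].

Definition L2_nonzero : set ('rV[R]_d -> R[i]) :=
  [set f | L2 f /\ ~ {ae lebesgue_rV R d, forall x, f x = 0}].

Definition p_star : R := (2^-1 - d%:R^-1)^-1.

End wigner.
Arguments L2 R d : clear implicits.
Arguments L2_nonzero R d : clear implicits.

(* Main.v *)
From mathcomp Require Import all_boot all_order all_algebra.
From mathcomp Require Import all_classical all_reals all_analysis.
From mathcomp Require Import measurable_realfun ess_sup_inf complex ring lra zify.
Require Import Defs.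
Set Implicit Arguments.
Unset Strict Implicit.
Unset Printing Implicit Defensive.
Import Order.TTheory GRing.Theory Num.Theory.
Import numFieldNormedType.Exports.
Local Open Scope classical_set_scope.
Local Open Scope ring_scope.

(** One explicit function, placed at a point of phase space chosen from
    [Omega], has a Born-Jordan distribution of infinite norm. It is a wave
    packet [exp(2 pi i xi0 . t) * g(t - x0)], where [g] is a compactly supported
    step function of the sup norm taking the value [2^(n d / 2) / (n + 1)] at
    distance about [2^-n] from the origin. This is just square integrable: the
    layer at distance [2^-n] contributes [1 / (n + 1)^2] up to a constant
    ([integral_profile_sqr_affine]).

    By covariance under time-frequency shifts the distribution at [z] is
    governed by [x = z.1 - x0] and [eta = z.2 - xi0], and equals the integral
    over [tau] and [y] of
    [exp(- 2 pi i eta . y) * g(x + tau y) * g(x - (1 - tau) y)].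
    The support of [g] confines [y] to a bounded set, so for small [eta] the
    real part of the exponential is bounded below and nothing cancels
    ([wigner_kernel_bounds]). When [tau] is below [2^-j] and [x] is within
    [2^-(j+1)] of the origin, the first factor is at least
    [2^(j d / 2) / (j + 1)] for all [y] in the unit cube centered at the origin,
    outside a null set. Integrating in [tau] over dyadic intervals, the
    distribution is at least a constant times the sum [S_k] of
    [2^(j (d/2 - 1)) / (j + 1)] over [j < k] as soon as [x] is nonzero and
    within [2^-k] of the origin, for all small [eta]
    ([Re_born_jordan_packet_ge]). A divergent real integral has the value [0] by
    convention, so this lower bound also requires the integrals to be finite; for
    [x != 0] they are, uniformly in [tau] ([integral_overlap_le]).

    The sums [S_k] dominate harmonic sums, hence are unbounded even for [d = 2];
    and [S_k ^ p * 2^(- k d)] is unbounded exactly because [p] exceeds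
    [2 d / (d - 2)] ([singular_sum_powR_unbounded]). It remains to choose [x0]
    and [xi0] so that [Omega] meets the region [|x| <= 2^-k], [eta] small, in
    measure at least a constant times [2^(- k d)] for every [k]. This is a
    pigeonhole argument on nested dyadic cubes in the space variable
    ([exists_concentration_point]). The norm is then infinite by comparing with
    the value [S_k] on that region, for each [k] separately. *)

(** * The radial profile *)

Section profile.
Context (R : realType) (d : nat).
Implicit Types (r s : R) (n j K : nat).

(** The square of [height n] times the volume [2^(- n d)] of a ball of radius
    [2^-n] is summable in [n], but [height n * 2^-n] is not, even for [d = 2]:
    the first property gives square integrability, the second the singularity of
    the Born-Jordan distribution. *)
Definition height n : R := Num.sqrt 2 ^+ (n * d) / n.+1%:R.

(** The largest [n] with [r <= 2^-n], when [0 < r <= 1]; it is [0] at [r = 0],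
    which makes the profile finite at its singular point. *)
Definition dyadic_scale r : nat := trunc_log 2 (Num.truncn r^-1).

Definition profile r : R := if r <= 1 then height (dyadic_scale r) else 0.

Lemma height0 : height 0 = 1.
Proof. by rewrite /height mul0n expr0 divr1. Qed.

Lemma height_ge0 n : 0 <= height n.
Proof. by rewrite divr_ge0 ?exprn_ge0 ?sqrtr_ge0. Qed.

Lemma sqr_height n : height n ^+ 2 = 2 ^+ (n * d) / n.+1%:R ^+ 2.
Proof. by rewrite /height exprMn exprVn -exprM mulnC exprM sqr_sqrtr. Qed.

Hypothesis d_ge2 : (2 <= d)%N.

Lemma sqrt2X_ge2 : 2 <= Num.sqrt 2 ^+ d :> R.
Proof.
rewrite -{1}(@sqr_sqrtr R 2)// ler_weXn2l//.
by rewrite -[leLHS]sqrtr1 ler_wsqrtr// ler1n.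
Qed.

Lemma height_nondecreasing n m : (n <= m)%N -> height n <= height m.
Proof.
elim: m => [|m IH]; first by rewrite leqn0 => /eqP->.
rewrite leq_eqVlt => /predU1P[->//|]; rewrite ltnS => /IH /le_trans; apply.
rewrite /height mulSn addnC exprD -mulrA ler_wpM2l ?exprn_ge0 ?sqrtr_ge0//.
rewrite -div1r ler_pdivrMr// mulrAC ler_pdivlMr// mul1r.
apply: (@le_trans _ _ (2 * m.+1%:R)); last by rewrite ler_wpM2r// sqrt2X_ge2.
by rewrite -natrM ler_nat; lia.
Qed.

Lemma height_ge1 n : 1 <= height n.
Proof. by rewrite -height0 height_nondecreasing. Qed.

Lemma profile_ge0 r : 0 <= profile r.
Proof. by rewrite /profile; case: ifP => // _; exact: height_ge0. Qed.

Lemma profile_out r : 1 < r -> profile r = 0.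
Proof. by rewrite /profile ltNge => /negbTE->. Qed.

Lemma profile_ge1 r : r <= 1 -> 1 <= profile r.
Proof. by rewrite /profile => ->; exact: height_ge1. Qed.

(** The profile takes no value strictly between [0] and [1], so estimates of its
    square also serve as estimates of its integral. *)
Lemma profile_le_sqr r : profile r <= profile r ^+ 2.
Proof.
have [r1|r1] := leP r 1; last by rewrite profile_out// expr0n.
by rewrite ler_eXnr// profile_ge1.
Qed.

Lemma dyadic_scale_le r : 0 <= r -> r <= 1 -> r <= 2^-1 ^+ dyadic_scale r.
Proof.
rewrite le_eqVlt => /predU1P[<- _|r0 r1]; first by rewrite exprn_ge0.
have r1' : 1 <= r^-1 by rewrite invf_ge1.
rewrite exprVn -[leLHS]invrK lef_pV2 ?posrE ?exprn_gt0 ?invr_gt0//.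
apply: (@le_trans _ _ (Num.truncn r^-1)%:R); last by rewrite truncn_le invr_ge0 ltW.
by rewrite -natrX ler_nat /dyadic_scale trunc_logP// truncn_gt0.
Qed.

Lemma dyadic_scale_ge r j : 0 < r -> r <= 2^-1 ^+ j -> (j <= dyadic_scale r)%N.
Proof.
move=> r0; rewrite exprVn => rj.
have jr : 2 ^+ j <= r^-1.
  by rewrite -[leLHS]invrK lef_pV2 ?posrE ?exprn_gt0 ?invr_gt0.
by rewrite /dyadic_scale trunc_log_max// truncn_ge_nat ?natrX// invr_ge0 ltW.
Qed.

Lemma dyadic_scale_anti r s : 0 < r -> r <= s -> (dyadic_scale s <= dyadic_scale r)%N.
Proof.
move=> r0 rs; apply/leq_trunc_log/le_truncn.
by rewrite lef_pV2// posrE// (lt_le_trans r0).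
Qed.

Lemma profile_ge_height r j : 0 < r -> r <= 2^-1 ^+ j -> height j <= profile r.
Proof.
move=> r0 rj; rewrite /profile ifT; last first.
  by rewrite (le_trans rj)// exprn_ile1// invf_le1// ler1n.
exact/height_nondecreasing/dyadic_scale_ge.
Qed.

Lemma profile_le_height r K : 2^-1 ^+ K <= r -> profile r <= height K.
Proof.
move=> Kr; rewrite /profile; case: ifPn => [r1|_]; last exact: height_ge0.
apply: height_nondecreasing.
apply: (leq_trans (dyadic_scale_anti _ Kr)); first by rewrite exprn_gt0.
by rewrite /dyadic_scale exprVn invrK -natrX natrK trunc_expnK.
Qed.

(** Away from the origin the profile is a nondecreasing function of [1 / r]. *)
Lemma measurable_profile : measurable_fun [set: R] profile.
Proof.
pose G s : R := if 1 <= s then height (trunc_log 2 (Num.truncn s)) else 0.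
have mG : measurable_fun [set: R] G.
  rewrite -[G]opprK; apply: measurable_funN.
  apply: nonincreasing_measurable => // s t /= st; rewrite lerN2 /G.
  case: ifPn => [s1|_]; last by case: ifP => // _; exact: height_ge0.
  by rewrite (le_trans s1 st); apply/height_nondecreasing/leq_trunc_log/le_truncn.
rewrite (_ : [set: R] = `]-oo, 0] `|` `]0, +oo[); last first.
  apply/esym/seteqP; split=> // x _ /=; rewrite !in_itv/= andbT.
  by case: (leP x 0); [left|right].
apply/measurable_funU => //; split.
  apply: (eq_measurable_fun (cst 1 : R -> R)) => //= r; rewrite inE/= in_itv/= => r0.
  rewrite /profile (le_trans r0)// /dyadic_scale.
  suff -> : Num.truncn r^-1 = 0%N by rewrite trunc_log0 height0.
  by apply/truncn0Pn; rewrite -ltNge (@le_lt_trans _ _ 0)// invr_le0.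
apply: (eq_measurable_fun (G \o GRing.inv)).
  move=> r; rewrite inE/= in_itv/= andbT => r0.
  by rewrite /G /profile/= invf_ge1.
apply: measurableT_comp => //; apply: open_continuous_measurable_fun => // r.
by rewrite inE/= in_itv/= andbT => r0; apply: inv_continuous; rewrite gt_eqF.
Qed.

End profile.

(** * The sup norm and the volume of its balls *)

Section supnorm.
Context (R : realType) (d : nat).
Implicit Types (u v x y : 'rV[R]_d) (r : R).

Definition supnorm u : R := \big[Num.max/0]_(i < d) `|u ord0 i|.

Lemma supnorm_ge0 u : 0 <= supnorm u.
Proof. exact: bigmax_ge_id. Qed.

Lemma le_supnorm u i : `|u ord0 i| <= supnorm u.
Proof. exact: le_bigmax. Qed.

Lemma supnormP u r : 0 <= r ->
  reflect (forall i, `|u ord0 i| <= r) (supnorm u <= r).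
Proof.
move=> r0; apply: (iffP idP) => [ur i|ur].
  exact: le_trans (le_supnorm u i) ur.
by apply: bigmax_le => // i _; exact: ur.
Qed.

Lemma supnormD u v : supnorm (u + v) <= supnorm u + supnorm v.
Proof.
apply/supnormP => [|i]; first by rewrite addr_ge0 ?supnorm_ge0.
by rewrite mxE (le_trans (ler_normD _ _))// lerD// le_supnorm.
Qed.

Lemma supnormZ a u : supnorm (a *: u) <= `|a| * supnorm u.
Proof.
apply/supnormP => [|i]; first by rewrite mulr_ge0 ?supnorm_ge0.
by rewrite mxE normrM ler_wpM2l// le_supnorm.
Qed.

Lemma supnorm_gt0 u : u != 0 -> 0 < supnorm u.
Proof.
move=> u0; rewrite lt_neqAle supnorm_ge0 andbT eq_sym.
apply: contraNneq u0 => un; apply/eqP/rowP => i; rewrite mxE.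
by apply/eqP; rewrite -normr_le0 -un le_supnorm.
Qed.

Lemma measurable_supnorm : measurable_fun [set: 'rV[R]_d] supnorm.
Proof.
rewrite /supnorm; elim: (index_enum _) => [|i s IH].
  by under eq_fun do rewrite big_nil; exact: measurable_cst.
under eq_fun do rewrite big_cons.
apply: measurable_maxr => //; apply: measurableT_comp => //.
exact: measurable_coord.
Qed.

Lemma measurable_affine x (a : R) :
  measurable_fun [set: 'rV[R]_d] (fun y : 'rV[R]_d => x + a *: y).
Proof.
apply/measurable_fun_rVP => i.
rewrite (_ : (fun _ => _) = (fun y : 'rV[R]_d => x ord0 i + a * y ord0 i)); last first.
  by apply/funext => y; rewrite !mxE.
by apply: measurable_funD => //; apply: measurable_funM => //; exact: measurable_coord.
Qed.

Lemma measurable_supnorm_ball x (a r : R) :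
  measurable [set y | supnorm (x + a *: y) <= r].
Proof.
have := measurableT_comp measurable_supnorm (measurable_affine x a).
move=> /(_ measurableT `]-oo, r]%classic (measurable_itv _)).
by rewrite setTI; congr measurable; apply/seteqP; split => y; rewrite /= in_itv.
Qed.

Lemma rV_set1E x : [set x] = [set y | supnorm (- x + 1 *: y) <= 0].
Proof.
apply/seteqP; split=> y /=; rewrite scale1r.
  by move=> ->; rewrite addNr; apply/supnormP => // i; rewrite mxE normr0.
move=> y0; apply/eqP; rewrite -subr_eq0; apply: contraTT y0 => yx.
by rewrite -ltNge addrC supnorm_gt0.
Qed.

Lemma measurable_rV_set1 x : measurable [set x].
Proof. by rewrite rV_set1E; exact: measurable_supnorm_ball. Qed.

Lemma lebesgue_rV_ball x (a r : R) : 0 < a -> 0 <= r ->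
  lebesgue_rV R d [set y | supnorm (x + a *: y) <= r] = ((2 * r / a) ^+ d)%:E.
Proof.
move=> a0 r0.
pose I i := `[(- r - x ord0 i) / a, (r - x ord0 i) / a]%classic.
transitivity (lebesgue_rV R d [set y : 'rV[R]_d | forall i, I i (y ord0 i)]).
  congr (lebesgue_rV R d _); apply/seteqP; split=> y /=.
    move=> /supnormP - /(_ r0) yr i; have := yr i.
    rewrite !mxE /I/= in_itv/= ler_pdivrMr// ler_pdivlMr// ler_norml => /andP[? ?].
    by apply/andP; split; lra.
  move=> yr; apply/supnormP => // i; have := yr i.
  rewrite !mxE /I/= in_itv/= ler_pdivrMr// ler_pdivlMr// ler_norml => /andP[? ?].
  by apply/andP; split; lra.
rewrite lebesgue_rV_box; last by move=> i; exact: measurable_itv.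
  under eq_bigr => i _.
    rewrite lebesgue_measure_itv/= lte_fin.
    rewrite (_ : (if _ then _ else _) = (2 * r / a)%:E); first over.
    case: ltP => [_|].
      by rewrite -EFinD; congr EFin; rewrite -mulrBl; congr (_ / _); ring.
    rewrite ler_pM2r ?invr_gt0// lerD2r => rr.
    by rewrite (_ : r = 0) ?mulr0 ?mul0r//; lra.
  by rewrite big_const cardT size_enum_ord; elim: (d) => [|n IH]//=; rewrite IH -EFinM -exprS.
Qed.

Lemma lebesgue_rV_point x : (0 < d)%N -> lebesgue_rV R d [set x] = 0%E.
Proof.
move=> d0; rewrite [X in lebesgue_rV R d X]rV_set1E lebesgue_rV_ball//.
by rewrite mulr0 mul0r expr0n gtn_eqF.
Qed.

End supnorm.

(** * Square integrability of the profile *)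

Section profile_square_integrable.
Context (R : realType) (d : nat).
Hypothesis d_ge2 : (2 <= d)%N.

Local Notation profile := (@profile R d).

Lemma sum_inv_sqr_le2 n : \sum_(0 <= k < n) k.+1%:R ^- 2 <= 2 :> R.
Proof.
have [->|n0] := posnP n; first by rewrite big_nil.
suff : \sum_(0 <= k < n) k.+1%:R ^- 2 <= 2 - n%:R^-1 :> R.
  by move/le_trans; apply; rewrite gerBl.
elim: n n0 => // -[_ _|n /(_ isT) IH _].
  by rewrite big_nat1 expr1n; lra.
rewrite big_nat_recr//= (le_trans (lerD IH (lexx _)))//.
have tele : n.+2%:R ^- 2 <= n.+1%:R^-1 - n.+2%:R^-1 :> R.
  rewrite (_ : n.+1%:R^-1 - n.+2%:R^-1 = (n.+1%:R * n.+2%:R)^-1); last first.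
    rewrite -[n.+2%:R]natr1; have := ltr0Sn R n; move: (n.+1%:R) => t t0.
    by field; apply/andP; split; rewrite gt_eqF//; lra.
  by rewrite expr2 lef_pV2 ?posrE ?mulr_gt0// ler_wpM2r// ler_nat.
by rewrite -addrA lerD2l addrC -lerBrDr opprK addrC.
Qed.

Let weight k : \bar R := (2 ^+ d * k.+1%:R ^- 2)%:E.

Let sum_weight_le : (\sum_(0 <= k <oo) weight k <= (2 ^+ d * 2)%:E)%E.
Proof.
apply: lime_le; first by apply: is_cvg_nneseries => k _ _; rewrite lee_fin mulr_ge0.
apply: nearW => n; rewrite /weight sumEFin lee_fin -mulr_sumr ler_wpM2l//.
exact: sum_inv_sqr_le2.
Qed.

(** The square of the profile is dominated by the sum over [k] of
    [height k ^+ 2] on the ball of radius [2^-k], whose preimage under the affine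
    map is a cube of known volume; the [k]-th term integrates to a constant times
    [1 / (k + 1) ^ 2]. *)
Lemma integral_profile_sqr_affine x (a : R) : 0 < a ->
  (\int[lebesgue_rV R d]_y (profile (supnorm (x + a *: y)) ^+ 2)%:E <=
     (2 ^+ d * 2 / a ^+ d)%:E)%E.
Proof.
move=> a0.
pose layer k : set 'rV[R]_d := [set y | supnorm (x + a *: y) <= 2^-1 ^+ k].
have mlayer k : measurable (layer k) by exact: measurable_supnorm_ball.
pose term k y : \bar R := ((height R d k ^+ 2)%:E * (\1_(layer k) y)%:E)%E.
have term_ge0 k y : (0 <= term k y)%E.
  by rewrite /term -EFinM lee_fin mulr_ge0// exprn_ge0// height_ge0.
have mterm k : measurable_fun setT (term k).
  apply: emeasurable_funM => //; apply/measurable_EFinP.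
  exact: measurable_indic.
apply: (@le_trans _ _ (\int[lebesgue_rV R d]_y (\sum_(0 <= k <oo) term k y))%E).
  apply: ge0_le_integral => //.
  - by move=> y _; rewrite lee_fin exprn_ge0// profile_ge0.
  - apply/measurable_EFinP; apply: measurable_funX.
    apply: measurableT_comp; first exact: measurable_profile.
    by apply: measurableT_comp (measurable_affine _ _); exact: measurable_supnorm.
  - by apply: ge0_emeasurable_sum => // k y _ _; exact: term_ge0.
  move=> y _; set r := supnorm _.
  have [r1|r1] := leP r 1; last first.
    by rewrite profile_out// expr0n; apply: nneseries_ge0.
  have inl : layer (dyadic_scale r) y by apply: dyadic_scale_le => //; exact: supnorm_ge0.
  apply: le_trans (nneseries_lim_ge (dyadic_scale r).+1 _); last by [].
  rewrite big_nat_recr//= /term indicE mem_set// mule1 /profile r1.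
  by apply: leeDr; apply: sume_ge0 => i _; exact: term_ge0.
rewrite integral_nneseries//.
have -> : (2 ^+ d * 2 / a ^+ d)%:E = ((a ^- d)%:E * (2 ^+ d * 2)%:E)%E :> \bar R.
  by rewrite -EFinM mulrC.
have a'0 : 0 < a ^- d by rewrite invr_gt0 exprn_gt0.
apply: le_trans (lee_wpmul2l _ sum_weight_le); last by rewrite lee_fin ltW.
rewrite -nneseriesZl; last by move=> k _; rewrite lee_fin mulr_ge0.
apply: lee_nneseries => [k _ _|k _]; first exact: integral_ge0.
rewrite /term ge0_integralZl//.
- rewrite integral_indic// setIT [X in (_ * X)%E](lebesgue_rV_ball _ a0)//.
  rewrite -!EFinM lee_fin sqr_height !exprMn !exprVn exprM.
  rewrite le_eqVlt; apply/orP; left; apply/eqP.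
  have pk : (2 ^+ k) ^+ d != 0 :> R by rewrite !expf_neq0.
  have pa : a ^+ d != 0 by rewrite expf_neq0// gt_eqF.
  by field; rewrite pk pa addrC natr1 pnatr_eq0.
- by apply/measurable_EFinP; exact: measurable_indic.
- by rewrite lee_fin exprn_ge0// height_ge0.
Qed.

End profile_square_integrable.

(** * Integrals of functions of unknown measurability *)

Section integral_bounds.
Context d0 (T : measurableType d0) (R : realType) (mu : {measure set T -> \bar R}).
Local Open Scope ereal_scope.

(** The integral of a nonnegative function is the supremum of the integrals of the
    simple functions below it, hence monotone whether or not the functions are
    measurable. It is applied to Wigner distributions as functions of [tau] and
    to Born-Jordan distributions. *)
Lemma le_integral_nonmeasurable (D : set T) (f g : T -> \bar R) :
  (forall x, D x -> 0 <= f x) -> (forall x, D x -> f x <= g x) ->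
  \int[mu]_(x in D) f x <= \int[mu]_(x in D) g x.
Proof.
move=> f0 fg; rewrite !ge0_integralE//; last first.
  by move=> x Dx; rewrite (le_trans (f0 _ Dx))// fg.
apply: le_ereal_sup => _ [h hf <-]; exists h => // x.
apply: le_trans (hf x) _; rewrite /patch; case: ifPn => // /set_mem; exact: fg.
Qed.

Lemma sum_le_integral (D : set T) (f : T -> \bar R) k (I : 'I_k -> set T)
    (c : 'I_k -> R) :
  measurable D -> (forall x, D x -> 0 <= f x) ->
  (forall j, measurable (I j)) -> trivIset setT I -> (forall j, I j `<=` D) ->
  (forall j, (0 <= c j)%R) -> (forall j x, I j x -> (c j)%:E <= f x) ->
  \sum_(j < k) (c j)%:E * mu (I j) <= \int[mu]_(x in D) f x.
Proof.
move=> mD f0 mI tI ID c0 cf.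
have mi j : measurable_fun D (fun x => (\1_(I j) x)%:E : \bar R).
  by apply/measurable_EFinP; exact: measurable_indic.
apply: (@le_trans _ _ (\int[mu]_(x in D) (\sum_(j < k) (c j)%:E * (\1_(I j) x)%:E))).
  rewrite ge0_integral_sum//.
  - apply: lee_sum => j _; rewrite ge0_integralZl//.
    + by rewrite integral_indic// setIidl.
    + by rewrite lee_fin.
  - by move=> j; exact: emeasurable_funM.
  - by move=> j x _; rewrite -EFinM lee_fin mulr_ge0.
apply: le_integral_nonmeasurable => x Dx.
  by apply: sume_ge0 => j _; rewrite -EFinM lee_fin mulr_ge0.
have [[j Ijx]|nI] := pselect (exists j, I j x).
  rewrite (bigD1 j)//= big1 => [|i ij].
    by rewrite adde0 indicE mem_set// mule1 cf.
  rewrite indicE memNset ?mule0// => Iix; move/eqP: ij; apply.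
  by apply: tI => //; exists x.
rewrite big1 ?f0// => j _; rewrite indicE memNset ?mule0// => Ijx.
by apply: nI; exists j.
Qed.

Lemma measure_setD_null (A N : set T) : measurable A -> measurable N ->
  mu N = 0 -> mu (A `\` N) = mu A.
Proof.
move=> mA mN N0; rewrite (measureDI mu mA mN).
by rewrite (@subset_measure0 _ _ _ _ (A `&` N) N)// ?adde0//; exact: measurableI.
Qed.

End integral_bounds.

(** * Wigner distributions of a singular wave packet *)

Section packet.
Context (R : realType) (d : nat).
Hypothesis d_ge2 : (2 <= d)%N.
Implicit Types (x y xi eta u v : 'rV[R]_d) (tau : R).

Local Notation profile := (@profile R d).
Local Notation height := (@height R d).
Local Notation lambda := (lebesgue_rV R d).
Local Open Scope complex_scope.

Definition packet x0 xi0 : 'rV[R]_d -> R[i] := fun t =>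
  expi (2 * pi * dotrV xi0 t) * (profile (supnorm (t - x0)))%:C.

Lemma expiD (a b : R) : expi (a + b) = expi a * expi b.
Proof. by rewrite /expi cosD sinD; simpc; congr (_ +i* _); rewrite addrC [sin a * _]mulrC mulrC. Qed.

Lemma conjc_expi (a : R) : conjc (expi a) = expi (- a).
Proof. by rewrite /expi cosN sinN. Qed.

Lemma dotrVDr xi u v : dotrV xi (u + v) = dotrV xi u + dotrV xi v.
Proof. by rewrite /dotrV -big_split; apply: eq_bigr => i _; rewrite mxE mulrDr. Qed.

Lemma dotrVZr xi a u : dotrV xi (a *: u) = a * dotrV xi u.
Proof. by rewrite /dotrV mulr_sumr; apply: eq_bigr => i _; rewrite mxE mulrCA. Qed.

Lemma dotrVBl xi eta u : dotrV (xi - eta) u = dotrV xi u - dotrV eta u.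
Proof. by rewrite /dotrV -sumrB; apply: eq_bigr => i _; rewrite !mxE mulrBl. Qed.

Lemma dotrVBr xi u v : dotrV xi (u - v) = dotrV xi u - dotrV xi v.
Proof. by rewrite dotrVDr -scaleN1r dotrVZr mulN1r. Qed.

Lemma normr_dotrV_le eta y : `|dotrV eta y| <= d%:R * (supnorm eta * supnorm y).
Proof.
apply: (le_trans (ler_norm_sum _ _ _)).
rewrite mulr_natl -[X in _ *+ X]card_ord -sumr_const ler_sum// => i _.
by rewrite normrM ler_pM// le_supnorm.
Qed.

(** The integrand of the [tau]-Wigner distribution at zero frequency offset. *)
Definition overlap x tau y : R :=
  profile (supnorm (x + tau *: y)) * profile (supnorm (x - (1 - tau) *: y)).

Definition wigner_kernel x eta tau y : R :=
  cos (2 * pi * dotrV eta y) * overlap x tau y.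

Lemma overlap_ge0 x tau y : 0 <= overlap x tau y.
Proof. by rewrite mulr_ge0// profile_ge0. Qed.

(** Time-frequency shifts act on the integrand pointwise: the phases of the
    two factors combine into the phase of [y] alone, because their arguments
    differ by [y]. *)
Lemma wigner_packet_integrand x0 xi0 z tau y :
  expi (- (2 * pi * dotrV z.2 y)) * packet x0 xi0 (z.1 + tau *: y) *
    conjc (packet x0 xi0 (z.1 - (1 - tau) *: y)) =
  expi (- (2 * pi * dotrV (z.2 - xi0) y)) *
  (overlap (z.1 - x0) tau y)%:C.
Proof.
have conjcM (a b : R[i]) : conjc (a * b) = conjc a * conjc b by exact: rmorphM.
have realM (a b : R) : (a * b)%:C = a%:C * b%:C by exact: rmorphM.
rewrite /packet /overlap conjcM conjc_expi conjc_real realM.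
rewrite [z.1 + tau *: y - x0]addrAC [z.1 - _ *: y - x0]addrAC.
have mulE (e1 e2 e3 p q : R[i]) : e1 * (e2 * p) * (e3 * q) = e1 * e2 * e3 * (p * q).
  by rewrite !mulrA [_ * p * e3]mulrAC.
rewrite mulE -!expiD; congr (expi _ * _).
by rewrite dotrVBl dotrVDr dotrVBr !dotrVZr; ring.
Qed.

Lemma Re_wigner_packet x0 xi0 z tau :
  complex.Re (wigner tau (packet x0 xi0) z) =
  \int[lambda]_y wigner_kernel (z.1 - x0) (z.2 - xi0) tau y.
Proof.
rewrite /wigner /Cintegral/=; apply: eq_Rintegral => y _.
rewrite [LHS](congr1 (@complex.Re R) (wigner_packet_integrand x0 xi0 z tau y)).
by rewrite /wigner_kernel /expi cosN/= mulr0 subr0.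
Qed.

Lemma profile_mul_neq0 u v : profile (supnorm u) * profile (supnorm v) != 0 ->
  supnorm u <= 1 /\ supnorm v <= 1.
Proof.
by split; rewrite leNgt; apply: contra_neqN H => /(@profile_out _ d) ->; rewrite ?mul0r ?mulr0.
Qed.

(** The two arguments of the profile differ by [y], and the profile lives on the
    unit ball: only [supnorm y <= 2] matters, so for a small frequency offset the
    phase stays in [-1, 1] and the oscillating factor between [cos 1] and [1]. *)
Lemma wigner_kernel_bounds x eta tau y : supnorm eta <= (4 * pi * d%:R)^-1 ->
  cos 1 * overlap x tau y <= wigner_kernel x eta tau y <= overlap x tau y.
Proof.
move=> eta_le; have := overlap_ge0 x tau y; rewrite /wigner_kernel.
have [->|/profile_mul_neq0[u1 v1] hh0] := eqVneq (overlap x tau y) 0.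
  by rewrite !mulr0 lexx.
(* [y] is the difference of two points of the unit ball *)
have y2 : supnorm y <= 2.
  have -> : y = (x + tau *: y) - (x - (1 - tau) *: y).
    by apply/rowP => i; rewrite !mxE; ring.
  apply: (le_trans (supnormD _ _)).
  rewrite -scaleN1r (_ : 2 = 1 + 1)// lerD// (le_trans (supnormZ _ _))//.
  by rewrite normrN1 mul1r.
have theta1 : `|2 * pi * dotrV eta y| <= 1.
  have pi0 := @pi_gt0 R.
  have d0 : 0 < d%:R :> R by rewrite ltr0n (leq_trans _ d_ge2).
  rewrite normrM ger0_norm ?mulr_ge0 ?pi_ge0//.
  apply: (@le_trans _ _ (2 * pi * (d%:R * ((4 * pi * d%:R)^-1 * 2)))).
    rewrite ler_wpM2l ?mulr_ge0 ?pi_ge0// (le_trans (normr_dotrV_le _ _))//.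
    by rewrite ler_wpM2l// ler_pM// supnorm_ge0.
  have cancel (a b : R) : 0 < a -> 0 < b -> 2 * a * (b * ((4 * a * b)^-1 * 2)) = 1.
    by move=> a0 b0; field; rewrite !gt_eqF.
  by rewrite cancel.
apply/andP; split; last by rewrite -[leRHS]mul1r ler_wpM2r// cos_le1.
rewrite ler_wpM2r// -[leRHS]cos_norm leNgt; apply: contraTN theta1 => theta1.
have in1 : (1 : R) \in `[0, pi] by rewrite in_itv/= ler01 (le_trans _ (@pi_ge2 R))// ler1n.
have [tpi|tpi] := leP `|2 * pi * dotrV eta y| pi.
  by move: theta1; rewrite ltr_cos ?in_itv/= ?normr_ge0//= -ltNge.
by rewrite -ltNge (lt_trans _ tpi)// (lt_le_trans _ (@pi_ge2 R))// ltr1n.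
Qed.

Lemma wigner_kernel_ge0 x eta tau y : supnorm eta <= (4 * pi * d%:R)^-1 ->
  0 <= wigner_kernel x eta tau y.
Proof.
move=> /(@wigner_kernel_bounds x eta tau y)/andP[+ _]; apply: le_trans.
by rewrite mulr_ge0 ?overlap_ge0// ltW// cos1_gt0.
Qed.

End packet.

(** * The Born-Jordan distribution near the singularity *)

Section born_jordan_packet.
Context (R : realType) (d : nat).
Hypothesis d_ge2 : (2 <= d)%N.
Implicit Types (x y xi eta u v : 'rV[R]_d) (tau : R).

Local Notation profile := (@profile R d).
Local Notation height := (@height R d).
Local Notation lambda := (lebesgue_rV R d).
Local Notation overlap := (@overlap R d).

Lemma supnormB u v : supnorm (u - v) <= supnorm u + supnorm v.
Proof.
by rewrite (le_trans (supnormD _ _))// lerD2l -scaleN1r (le_trans (supnormZ _ _))// normrN1 mul1r.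
Qed.

(** Each factor of the overlap may be singular, but not both at once: [x] is a
    convex combination of the two arguments [u] and [v], so one of them is far
    from the origin. If [tau] is too small for the scaling of [u] to be usable,
    then [u] is close to [x], and it is [v] that carries the singularity. *)
Lemma overlap_le x K tau y : 2^-1 ^+ K * 2 <= supnorm x -> 0 <= tau <= 1 ->
  overlap x tau y <= height K *
    ((2^-1 ^+ K.+1 <= tau)%R%:R * profile (supnorm (x + tau *: y)) ^+ 2 +
     (2^-1 ^+ K.+1 <= 1 - tau)%R%:R * profile (supnorm (x - (1 - tau) *: y)) ^+ 2).
Proof.
move=> Kx /andP[tau0 tau1].
set u := x + _ *: _; set v := x - _ *: _; set e := 2^-1 ^+ K.+1.
have hK0 : 0 <= height K by exact: height_ge0.
have hu0 : 0 <= profile (supnorm u) by exact: profile_ge0.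
have hv0 : 0 <= profile (supnorm v) by exact: profile_ge0.
rewrite /overlap -/u -/v.
have [->|/(profile_mul_neq0)[u1 v1]] := eqVneq (profile (supnorm u) * profile (supnorm v)) 0.
  by rewrite mulr_ge0// addr_ge0// mulr_ge0// exprn_ge0.
have yE : y = u - v by apply/rowP => i; rewrite !mxE; ring.
have y2 : supnorm y <= 2 by rewrite yE (le_trans (supnormB _ _))// (_ : 2 = 1 + 1)// lerD.
have rE : 2^-1 ^+ K = 2 * e by rewrite /e exprS mulrA divff// mul1r.
have e_half : e <= 2^-1.
  by rewrite /e exprS ler_piMr// exprn_ile1// invf_le1// ler1n.
have [/andP[etau Kv]|Nv] := boolP ((e <= tau) && (2^-1 ^+ K <= supnorm v)).
  rewrite etau mul1r mulrC ler_pM//; first by rewrite profile_le_height.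
  rewrite (le_trans (profile_le_sqr d_ge2 _))// lerDl mulr_ge0// exprn_ge0//.
have [/andP[etau Ku]|Nu] := boolP ((e <= 1 - tau) && (2^-1 ^+ K <= supnorm u)).
  rewrite etau mul1r ler_pM//; first by rewrite profile_le_height.
  by rewrite (le_trans (profile_le_sqr d_ge2 _))// lerDr mulr_ge0// exprn_ge0.
exfalso; move: Nv Nu; rewrite !negb_and -!ltNge rE.
have xv : supnorm x <= supnorm v + (1 - tau) * supnorm y.
  have {1}-> : x = v + (1 - tau) *: y by rewrite /v subrK.
  rewrite (le_trans (supnormD _ _))// lerD2l (le_trans (supnormZ _ _))//.
  by rewrite ger0_norm ?subr_ge0.
have xu : supnorm x <= supnorm u + tau * supnorm y.
  have {1}-> : x = u - tau *: y by rewrite /u addrK.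
  rewrite (le_trans (supnormB _ _))// lerD2l (le_trans (supnormZ _ _))//.
  by rewrite ger0_norm.
have xuv : supnorm x <= supnorm u + supnorm v.
  have {1}-> : x = (1 - tau) *: u + tau *: v by apply/rowP => i; rewrite !mxE; ring.
  rewrite (le_trans (supnormD _ _))// lerD// (le_trans (supnormZ _ _))//.
    by rewrite ger0_norm ?subr_ge0// ler_piMl ?supnorm_ge0// lerBlDr lerDl.
  by rewrite ger0_norm// ler_piMl ?supnorm_ge0.
move: Kx; rewrite rE => Kx.
have tyle : tau * supnorm y <= tau * 2 by rewrite ler_wpM2l.
have t'yle : (1 - tau) * supnorm y <= (1 - tau) * 2 by rewrite ler_wpM2l// subr_ge0.
by move=> /orP[?|?] /orP[?|?]; lra.
Qed.

Lemma measurable_overlap x tau : measurable_fun [set: 'rV[R]_d] (overlap x tau).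
Proof.
apply: measurable_funM; apply: measurableT_comp; try exact: measurable_profile.
  by apply: measurableT_comp (measurable_affine _ _); exact: measurable_supnorm.
under eq_fun do rewrite -scaleNr.
by apply: measurableT_comp (measurable_affine _ _); exact: measurable_supnorm.
Qed.

Lemma exists_dyadic_le (e : R) : 0 < e -> exists K, 2^-1 ^+ K <= e.
Proof.
move=> e0; exists (Num.truncn e^-1).+1.
rewrite exprVn invf_ple ?posrE ?exprn_gt0// (le_trans (ltW (truncnS_gt _)))//.
by rewrite -natrX ler_nat ltnW// ltn_expl.
Qed.

(** The change of variables [x + tau *: y] costs [1 / tau ^ d], which is not
    integrable near [0]. By [overlap_le] it is only made when [tau] is bounded
    below, and similarly for [1 - tau], which gives a bound uniform in [tau]. *)
Lemma integral_overlap_le x : x != 0 -> exists M : R, forall tau, 0 < tau < 1 ->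
  (\int[lambda]_y (overlap x tau y)%:E <= M%:E)%E.
Proof.
move=> x0; have [K Kx] : exists K, 2^-1 ^+ K <= supnorm x / 2.
  by apply: exists_dyadic_le; rewrite divr_gt0// supnorm_gt0.
have {}Kx : 2^-1 ^+ K * 2 <= supnorm x by rewrite -ler_pdivlMr.
set e : R := 2^-1 ^+ K.+1; have e0 : 0 < e by rewrite exprn_gt0.
pose B : R := 2 ^+ d * 2 / e ^+ d.
have B0 : 0 <= B by rewrite /B divr_ge0 ?mulr_ge0 ?exprn_ge0// ltW.
have intB (x' : 'rV[R]_d) s : 0 < s ->
    (\int[lambda]_y ((e <= s)%R%:R%:E * (profile (supnorm (x' + s *: y)) ^+ 2)%:E) <= B%:E)%E.
  move=> s0; have [es|_] := leP e s; last first.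
    by under eq_integral do rewrite mul0e; rewrite integral0 lee_fin.
  under eq_integral do rewrite mul1e.
  apply: le_trans (integral_profile_sqr_affine d_ge2 x' s0) _.
  rewrite lee_fin ler_wpM2l ?mulr_ge0 ?exprn_ge0// lef_pV2 ?posrE ?exprn_gt0//.
  by rewrite lerXn2r// nnegrE ltW.
have mprof (x' : 'rV[R]_d) s (b : bool) : measurable_fun [set: 'rV[R]_d]
    (fun y : 'rV[R]_d => b%:R%:E * (profile (supnorm (x' + s *: y)) ^+ 2)%:E : \bar R)%E.
  apply: emeasurable_funM => //; apply/measurable_EFinP; apply: measurable_funX.
  apply: measurableT_comp; first exact: measurable_profile.
  by apply: measurableT_comp (measurable_affine _ _); exact: measurable_supnorm.
exists (height K * (B + B)) => tau /andP[tau0 tau1].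
pose F y := ((e <= tau)%R%:R%:E * (profile (supnorm (x + tau *: y)) ^+ 2)%:E : \bar R)%E.
pose F' y := ((e <= 1 - tau)%R%:R%:E *
  (profile (supnorm (- x + (1 - tau) *: y)) ^+ 2)%:E : \bar R)%E.
have hK0 : 0 <= height K by exact: height_ge0.
have F0 y : (0 <= F y)%E by rewrite /F -EFinM lee_fin mulr_ge0// exprn_ge0// profile_ge0.
have F'0 y : (0 <= F' y)%E by rewrite /F' -EFinM lee_fin mulr_ge0// exprn_ge0// profile_ge0.
have mF : measurable_fun setT F by exact: mprof.
have mF' : measurable_fun setT F' by exact: mprof.
apply: (@le_trans _ _ (\int[lambda]_y ((height K)%:E * (F y + F' y)))%E).
  apply: le_integral_nonmeasurable => y _; first by rewrite lee_fin overlap_ge0.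
  rewrite /F /F' -!EFinM lee_fin.
  have -> : supnorm (- x + (1 - tau) *: y) = supnorm (x - (1 - tau) *: y).
    by rewrite /supnorm; apply: eq_bigr => i _; rewrite !mxE -normrN opprD opprK.
  by apply: overlap_le => //; rewrite !ltW.
rewrite ge0_integralZl//; first last.
- by move=> y _; rewrite adde_ge0.
- exact: emeasurable_funD.
rewrite [leRHS]EFinM lee_wpmul2l ?lee_fin// ge0_integralD// EFinD.
by rewrite leeD// intB// subr_gt0.
Qed.

(** For [y] in the cube of side [1] centered at the origin, the point
    [x + tau *: y] lies in the ball of radius [2^-j], where the profile is at least
    [height j] except at the center, while the other argument stays in the unit ball. *)
Lemma integral_overlap_ge x tau j : 0 < tau -> tau < 2^-1 ^+ j ->
  supnorm x <= 2^-1 ^+ j.+1 ->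
  ((height j)%:E <= \int[lambda]_y (overlap x tau y)%:E)%E.
Proof.
move=> tau0 tauj xj.
pose cube : set 'rV[R]_d := [set y | supnorm (0 + 1 *: y) <= 2^-1].
(* the profile is not large at its singular point itself *)
pose sing : set 'rV[R]_d := [set - (tau^-1 *: x)].
have mcube : measurable cube by exact: measurable_supnorm_ball.
have msing : measurable sing by exact: measurable_rV_set1.
have jle1 : 2^-1 ^+ j <= 1 :> R by rewrite exprn_ile1// invf_le1// ler1n.
have tau1 : tau < 1 by exact: lt_le_trans jle1.
have jE : 2^-1 ^+ j.+1 = 2^-1 * 2^-1 ^+ j :> R by rewrite exprS.
have cubey y : cube y -> supnorm y <= 2^-1 by rewrite /cube/= add0r scale1r.
have bound : forall (i : 'I_1) y, (cube `\` sing) y ->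
    ((height j)%:E <= (overlap x tau y)%:E)%E.
  move=> _ y [/cubey y2 /= ysing].
  rewrite lee_fin -[leLHS]mulr1 ler_pM ?height_ge0//.
    apply: profile_ge_height => //.
      apply: supnorm_gt0; apply: contra_not_neq ysing => u0.
      apply/eqP; rewrite -subr_eq0 opprK -(inj_eq (scalerI (lt0r_neq0 tau0))) scaler0.
      by rewrite scalerDr scalerA divff ?gt_eqF// scale1r addrC u0.
    rewrite (le_trans (supnormD _ _))//.
    have : supnorm (tau *: y) <= tau * 2^-1.
      by rewrite (le_trans (supnormZ _ _))// gtr0_norm// ler_wpM2l// ltW.
    by lra.
  apply: profile_ge1 => //; rewrite (le_trans (supnormB _ _))//.
  have : supnorm ((1 - tau) *: y) <= (1 - tau) * 2^-1.
    by rewrite (le_trans (supnormZ _ _))// gtr0_norm ?subr_gt0// ler_wpM2l// subr_ge0 ltW.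
  by lra.
have := @sum_le_integral _ _ R lambda setT (fun y => (overlap x tau y)%:E) 1
  (fun=> cube `\` sing) (fun=> height j).
rewrite big_ord1 measure_setD_null//; last first.
  by apply: lebesgue_rV_point; rewrite (leq_trans _ d_ge2).
rewrite [X in (_ * X)%E](lebesgue_rV_ball 0 ltr01)// divff// divr1 expr1n mule1.
apply => //.
- by move=> y _; rewrite lee_fin overlap_ge0.
- by move=> _; exact: measurableD.
- by move=> i k _ _ _; rewrite !ord1.
- by move=> _; exact: height_ge0.
Qed.

(** This is the integral of the profile over the interval from [2^-k] to [1]. *)
Definition singular_sum k : R := \sum_(j < k) height j * 2^-1 ^+ j.+1.

(** On the dyadic interval [2^-(j+1) < tau < 2^-j] the Wigner distributions are at
    least [cos 1 * height j]. Their uniform upper bound ensures that the real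
    integrals in the definition of the distribution are those of the extended
    real line. *)
Lemma Re_born_jordan_packet_ge x0 xi0 z k : z.1 != x0 ->
  supnorm (z.1 - x0) <= 2^-1 ^+ k -> supnorm (z.2 - xi0) <= (4 * pi * d%:R)^-1 ->
  cos 1 * singular_sum k <= complex.Re (born_jordan (packet x0 xi0) z).
Proof.
rewrite -subr_eq0 => zx0 zk zeta.
set x := z.1 - x0 in zx0 zk *; set eta := z.2 - xi0 in zeta *.
have [M leM] := integral_overlap_le zx0.
have c1 := @cos1_gt0 R.
pose G tau := (\int[lambda]_y (wigner_kernel x eta tau y)%:E)%E.
have G0 tau : (0 <= G tau)%E.
  by apply: integral_ge0 => y _; rewrite lee_fin wigner_kernel_ge0.
have GM tau : 0 < tau < 1 -> (G tau <= M%:E)%E.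
  move=> /leM; apply: le_trans; apply: le_integral_nonmeasurable => y _.
    by rewrite lee_fin wigner_kernel_ge0.
  by rewrite lee_fin; have /andP[] := wigner_kernel_bounds d_ge2 x tau y zeta.
have fineG tau : 0 < tau < 1 -> (fine (G tau))%:E = G tau.
  move=> tau01; rewrite fineK// ge0_fin_numE//.
  by rewrite (le_lt_trans (GM _ tau01))// ltry.
pose U : set R := `]0, 1[%classic.
have BJ : complex.Re (born_jordan (packet x0 xi0) z) =
    fine (\int[lebesgue_measure]_(tau in U) G tau)%E.
  congr fine; apply: eq_integral => tau; rewrite inE /U [X in X -> _]/= in_itv => tau01.
  rewrite -fineG//; congr EFin; exact: Re_wigner_packet.
rewrite BJ -lee_fin fineK; last first.
  rewrite ge0_fin_numE; last by apply: integral_ge0 => tau _; exact: G0.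
  apply: (@le_lt_trans _ _ (\int[lebesgue_measure]_(tau in U) M%:E))%E.
    apply: le_integral_nonmeasurable => tau; first by move=> _; exact: G0.
    by rewrite /U/= in_itv/=; exact: GM.
  rewrite integral_cst//; last exact: measurable_itv.
  by rewrite [X in (_ * X)%E](lebesgue_measure_itv `]0%R, 1%R[)/= lte01 oppr0 adde0 mule1 ltry.
pose I (j : 'I_k) := `]2^-1 ^+ j.+1, 2^-1 ^+ j[%classic : set R.
have h0 : 0 <= 2^-1 :> R by rewrite invr_ge0.
have h1 : 2^-1 <= 1 :> R by rewrite invf_le1// ler1n.
have -> : (cos 1 * singular_sum k)%:E =
    (\sum_(j < k) (cos 1 * height j)%:E * lebesgue_measure (I j))%E.
  rewrite /singular_sum mulr_sumr -sumEFin; apply: eq_bigr => j _.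
  rewrite [X in (_ * X)%E](lebesgue_measure_itv `]2^-1 ^+ j.+1, 2^-1 ^+ j[)/= lte_fin exprS gtr_pMl ?exprn_gt0// invf_lt1// ltr1n.
  by rewrite -EFinD -EFinM mulrA; congr (_ * _)%:E; lra.
apply: sum_le_integral => //.
- exact: measurable_itv.
- by move=> j; exact: measurable_itv.
- move=> i j _ _ [tau []]; rewrite /I/= !in_itv/= => /andP[i1 i2] /andP[j1 j2].
  apply/val_inj; case: (ltngtP i j) => // /(ler_wiXn2l h0 h1) le.
    by have := lt_le_trans (lt_trans i1 j2) le; rewrite ltxx.
  by have := lt_le_trans (lt_trans j1 i2) le; rewrite ltxx.
- move=> j tau; rewrite /I /U/= !in_itv/= => /andP[t1 t2].
  by rewrite (le_lt_trans _ t1) ?exprn_ge0//= (lt_le_trans t2)// exprn_ile1.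
- by move=> j; rewrite mulr_ge0 ?height_ge0// ltW.
move=> j tau; rewrite /I/= in_itv/= => /andP[t1 t2].
have tau0 : 0 < tau by rewrite (le_lt_trans _ t1)// exprn_ge0.
apply: (@le_trans _ _ ((cos 1)%:E * \int[lambda]_y (overlap x tau y)%:E)%E).
  rewrite [leLHS]EFinM; apply: lee_wpmul2l; first by rewrite lee_fin ltW.
  apply: integral_overlap_ge => //.
  by rewrite (le_trans zk)// ler_wiXn2l//.
rewrite -ge0_integralZl//.
- apply: le_integral_nonmeasurable => y _.
    by rewrite -EFinM lee_fin mulr_ge0 ?overlap_ge0// ltW.
  rewrite -EFinM lee_fin.
  by have /andP[] := wigner_kernel_bounds d_ge2 x tau y zeta.
- by apply/measurable_EFinP; exact: measurable_overlap.
- by move=> y _; rewrite lee_fin overlap_ge0.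
- by rewrite lee_fin ltW.
Qed.

End born_jordan_packet.

(** * The packet is square integrable and nonzero *)

Section packet_L2.
Context (R : realType) (d : nat).
Hypothesis d_ge2 : (2 <= d)%N.
Variables x0 xi0 : 'rV[R]_d.

Local Notation profile := (@profile R d).
Local Notation f := (packet x0 xi0).
Local Notation h := (fun t : 'rV[R]_d => profile (supnorm (t - x0))).

Lemma measurable_dotrV (xi : 'rV[R]_d) : measurable_fun [set: 'rV[R]_d] (dotrV xi).
Proof.
apply: measurable_sum => i; apply: measurable_funM => //.
exact: measurable_coord.
Qed.

Lemma measurable_shifted_profile : measurable_fun [set: 'rV[R]_d] h.
Proof.
apply: measurableT_comp; first exact: measurable_profile.
apply: measurableT_comp; first exact: measurable_supnorm.
rewrite (_ : (fun t => _) = (fun t : 'rV[R]_d => - x0 + 1 *: t)).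
  exact: measurable_affine.
by apply/funext => t; rewrite scale1r addrC.
Qed.

Lemma normc_packet t : Normc.normc (f t) = h t.
Proof.
rewrite /packet /expi /=; set a := 2 * pi * _.
rewrite !mulr0 subr0 add0r !exprMn -mulrDl cos2Dsin2 mul1r sqrtr_sqr ger0_norm//.
exact: profile_ge0.
Qed.

Lemma CLnorm_packet_lty : (CLnorm (lebesgue_rV R d) 2%:E setT f < +oo)%E.
Proof.
rewrite /CLnorm patch_setT unlock; apply: poweR_lty.
rewrite (eq_integral (fun y : 'rV[R]_d => ((profile (supnorm (- x0 + 1 *: y))) ^+ 2)%:E)).
  apply: le_lt_trans (integral_profile_sqr_affine d_ge2 (- x0) ltr01) _.
  by rewrite ltry.
move=> y _; rewrite normc_packet scale1r [- x0 + y]addrC.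
by rewrite gee0_abs ?lee_fin ?profile_ge0// poweR_EFin powR_mulrn// profile_ge0.
Qed.

Lemma packet_L2_nonzero : L2_nonzero R d f.
Proof.
have mphase : measurable_fun [set: 'rV[R]_d] (fun t => 2 * pi * dotrV xi0 t).
  by apply: measurable_funM => //; exact: measurable_dotrV.
split.
  split; last exact: CLnorm_packet_lty.
    rewrite (_ : (fun t => _) = (fun t => cos (2 * pi * dotrV xi0 t) * h t)).
      apply: measurable_funM; last exact: measurable_shifted_profile.
      apply: measurableT_comp mphase.
      by apply: continuous_measurable_fun; exact: continuous_cos.
    by apply/funext => t; rewrite /packet /expi/= mulr0 subr0.
  rewrite (_ : (fun t => _) = (fun t => sin (2 * pi * dotrV xi0 t) * h t)).
    apply: measurable_funM; last exact: measurable_shifted_profile.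
    apply: measurableT_comp mphase.
    by apply: continuous_measurable_fun; exact: continuous_sin.
  by apply/funext => t; rewrite /packet /expi/= mulr0 add0r.
move=> [N [mN N0]] fN.
pose B := [set t : 'rV[R]_d | supnorm (- x0 + 1 *: t) <= 1].
have BN : B `<=` N.
  move=> t Bt; apply: fN => /= ft0.
  have := normc_packet t; rewrite ft0 /Normc.normc/= expr0n addr0 sqrtr0 => h0.
  have := @profile_ge1 R d d_ge2 (supnorm (t - x0)).
  by rewrite -h0 ler10; move: Bt; rewrite /B/= scale1r addrC => -> /(_ isT).
have B0 := subset_measure0 (measurable_supnorm_ball _ _ _) mN BN N0.
have := etrans (esym B0) (lebesgue_rV_ball (- x0) ltr01 ler01).
rewrite mulr1 divr1 => -[/esym/eqP].
by rewrite expf_eq0 pnatr_eq0 andbF.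
Qed.

End packet_L2.

(** * A point at which a measure concentrates *)

Section concentration.
Context d0 (T : measurableType d0) (R : realType) (mu : {measure set T -> \bar R}).

Lemma measure_gt0_countable_cover (I : countType) (F : I -> set T) (A : set T) :
  measurable A -> (forall i, measurable (F i)) -> \bigcup_i F i = setT ->
  (0 < mu A)%E -> exists i, (0 < mu (A `&` F i))%E.
Proof.
move=> mA mF FT A0; apply: contrapT => /forallNP noI; move: A0.
rewrite lt_neqAle => /andP[/eqP/nesym muA0 _]; apply: muA0.
have /(@measure_negligible _ _ _ mu)-> // : mu.-negligible A.
suff -> : A = \bigcup_k (if pickle_inv k is Some i then A `&` F i else set0).
  apply: negligible_bigcup => k; case: pickle_inv => [i|]; last exact: negligible_set0.
  exists (A `&` F i); split => //; first exact: measurableI.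
  by apply/eqP; rewrite eq_le measure_ge0 andbT leNgt; apply/negP; exact: noI.
apply/seteqP; split=> [x Ax|x [k _]]; last by case: pickle_inv => // i [].
have : [set: T] x by []; rewrite -FT => -[i _ Fix].
by exists (pickle i) => //; rewrite pickleK_inv.
Qed.

Context (d : nat) (X : T -> 'rV[R]_d).
Hypothesis mX : measurable_fun [set: T] X.
Variable E : set T.
Hypothesis mE : measurable E.

Definition cell (c : 'rV[R]_d) (k : nat) : set T :=
  E `&` [set t | forall i, c ord0 i <= X t ord0 i < c ord0 i + 2^-1 ^+ k].

Lemma measurable_cell c k : measurable (cell c k).
Proof.
apply: measurableI => //.
rewrite (_ : [set t | _] = \bigcap_(i in [set: 'I_d])
   ([set t | X t ord0 i < c ord0 i + 2^-1 ^+ k] `\` [set t | X t ord0 i < c ord0 i])).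
  apply: fin_bigcap_measurable => // i _.
  have mXi a : measurable [set t | X t ord0 i < a].
    have := measurableT_comp (@measurable_coord _ R d i) mX.
    move=> /(_ measurableT `]-oo, a[%classic (measurable_itv _)).
    by rewrite setTI; congr measurable; apply/seteqP; split => t; rewrite /= in_itv.
  by apply: measurableD; exact: mXi.
apply/seteqP; split=> t /=.
  by move=> ct i _ /=; have /andP[c1 c2] := ct i; split => //; apply/negP; rewrite -leNgt.
by move=> ct i; have [/= -> /negP] := ct i I; rewrite -leNgt => ->.
Qed.

Lemma cell_pigeonhole (c : 'rV[R]_d) k : exists c' : 'rV[R]_d,
  (forall i, c ord0 i <= c' ord0 i /\
     c' ord0 i + 2^-1 ^+ k.+1 <= c ord0 i + 2^-1 ^+ k) /\
  (mu (cell c k) <= (2 ^+ d)%:E * mu (cell c' k.+1))%E.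
Proof.
(* [s] tells which half of each side is kept *)
pose sub (s : {ffun 'I_d -> bool}) : 'rV[R]_d :=
  \row_i (c ord0 i + (s i)%:R * 2^-1 ^+ k.+1).
have half : 2^-1 ^+ k = 2^-1 ^+ k.+1 + 2^-1 ^+ k.+1 :> R.
  by rewrite exprS; lra.
have half0 : 0 <= 2^-1 ^+ k.+1 :> R by rewrite exprn_ge0.
have cover : cell c k `<=` \bigcup_(s in [set: {ffun 'I_d -> bool}]) cell (sub s) k.+1.
  move=> t [Et ct]; exists [ffun i => c ord0 i + 2^-1 ^+ k.+1 <= X t ord0 i] => //.
  split => // i; rewrite mxE ffunE; have /andP[c1 c2] := ct i.
  have [c3|c3] := leP (c ord0 i + 2^-1 ^+ k.+1) (X t ord0 i);
    by rewrite /= ?mul1r ?mul0r ?addr0; apply/andP; split; lra.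
have := @content_sub_fsum _ _ _ mu _ _ _ _ finite_finset
  (fun s _ => measurable_cell (sub s) k.+1) (measurable_cell c k) cover.
have -> : [set: {ffun 'I_d -> bool}] = [set` index_enum {ffun 'I_d -> bool}].
  by apply/seteqP; split => // s _ /=; rewrite mem_index_enum.
rewrite -fsbig_seq ?index_enum_uniq// => le_sum.
case: (@arg_maxP _ _ _ [ffun=> false] xpredT (fun s => mu (cell (sub s) k.+1))) => // s _ smax.
exists (sub s); split.
  by move=> i; rewrite mxE; case: (s i); rewrite /= ?mul1r ?mul0r; split; lra.
apply: (le_trans le_sum).
apply: (@le_trans _ _ (\sum_(i : {ffun 'I_d -> bool}) mu (cell (sub s) k.+1))%E).
  by apply: lee_sum => i _; exact: smax.
by rewrite sumr_const card_ffun card_bool card_ord -natrX mule_natl.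
Qed.

(** Bisecting cubes and always keeping a subcube with at least the average
    mass loses a factor [2 ^ d] per step, which is exactly the decay of the volume
    of the cubes; the kept cubes shrink to a point [x0]. *)
Lemma exists_concentration_point (c : 'rV[R]_d) : exists x0, forall k,
  (mu (cell c 0) <= (2 ^+ (k * d))%:E *
     mu (E `&` [set t | (supnorm (X t - x0) <= 2^-1 ^+ k)%R]))%E.
Proof.
have [next nextP] := choice (fun ck => cell_pigeonhole ck.1 ck.2).
pose corner := fix corner k := if k is k'.+1 then next (corner k', k') else c.
have cornerP k i : corner k ord0 i <= corner k.+1 ord0 i /\
    corner k.+1 ord0 i + 2^-1 ^+ k.+1 <= corner k ord0 i + 2^-1 ^+ k.
  exact: (nextP (corner k, k)).1.
have mass k : (mu (cell c 0) <= (2 ^+ (k * d))%:E * mu (cell (corner k) k))%E.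
  elim: k => [|k IH]; first by rewrite mul0n mul1e.
  apply: (le_trans IH); rewrite mulSn addnC exprD EFinM -muleA lee_wpmul2l ?lee_fin//.
  exact: (nextP (corner k, k)).2.
have nested k l i : corner l ord0 i <= corner (l + k)%N ord0 i /\
    corner (l + k)%N ord0 i + 2^-1 ^+ (l + k) <= corner l ord0 i + 2^-1 ^+ l.
  elim: k => [|k [IH1 IH2]]; first by rewrite addn0.
  by rewrite addnS; have [? ?] := cornerP (l + k)%N i; split; lra.
have half0 n : 0 <= 2^-1 ^+ n :> R by rewrite exprn_ge0.
have upper k l i : corner l ord0 i <= corner k ord0 i + 2^-1 ^+ k.
  have [kl|/ltnW lk] := leqP k l.
    by have [] := nested (l - k)%N k i; rewrite subnKC//; have := half0 l; lra.
  by have [] := nested (k - l)%N l i; rewrite subnKC//; have := half0 k; lra.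
(* the lower corners increase, and stay below every upper corner *)
pose x0 : 'rV[R]_d := \row_i sup (range (fun k => corner k ord0 i)).
have x0ge k i : corner k ord0 i <= x0 ord0 i.
  rewrite mxE; apply: ub_le_sup; last by exists k.
  by exists (corner 0%N ord0 i + 2^-1 ^+ 0) => _ [l _ <-]; exact: upper.
have x0le k i : x0 ord0 i <= corner k ord0 i + 2^-1 ^+ k.
  rewrite mxE; apply: ge_sup; first by exists (corner 0%N ord0 i), 0%N.
  by move=> _ [l _ <-]; exact: upper.
exists x0 => k; apply: (le_trans (mass k)); apply: lee_wpmul2l; first by rewrite lee_fin.
apply: le_measure; rewrite ?inE.
- exact: measurable_cell.
- apply: measurableI => //.
  have := mX measurableT (measurable_supnorm_ball (- x0) 1 (2^-1 ^+ k)).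
  rewrite setTI; congr measurable; apply/seteqP; split => t /=;
    by rewrite scale1r addrC.
move=> t [Et ct]; split => //=; apply/supnormP => // i.
rewrite !mxE ler_norml; have /andP[c1 c2] := ct i.
by have := x0ge k i; have := x0le k i; rewrite !mxE => ? ?; apply/andP; split; lra.
Qed.

End concentration.

(** * Growth of the singular sums *)

Section growth.
Context (R : realType) (d : nat).
Hypothesis d_ge2 : (2 <= d)%N.

Local Notation singular_sum := (@singular_sum R d).

Lemma singular_sum_ge0 k : 0 <= singular_sum k.
Proof. by apply: sumr_ge0 => j _; rewrite mulr_ge0 ?height_ge0// exprn_ge0. Qed.

(** As [2 ^ (d / 2) >= 2], each term is at least that of half a harmonic series. *)
Lemma singular_sum_unbounded (M : R) : exists k, M <= singular_sum k.
Proof.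
apply: contrapT => /forallNP bounded; apply: (@dvg_harmonic R).
apply: nondecreasing_is_cvgn.
  apply/nondecreasing_seqP => n; rewrite seriesSr lerDl; exact: harmonic_ge0.
exists (2 * M) => _ [k _ <-].
have /negP := bounded k; rewrite -ltNge => /ltW; rewrite -(ler_pM2l (ltr0Sn R 1)).
apply: le_trans.
rewrite seriesEord /singular_sum mulr_sumr ler_sum// => j _ /=.
have hj : 2 ^+ j / j.+1%:R <= height R d j.
  rewrite /height ler_wpM2r ?invr_ge0// mulnC exprM.
  by rewrite lerXn2r ?nnegrE ?exprn_ge0 ?sqrtr_ge0// sqrt2X_ge2.
have p0 : 2^-1 ^+ j.+1 >= 0 :> R by rewrite exprn_ge0.
apply: le_trans (ler_wpM2l _ (ler_wpM2r p0 hj)); last by [].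
rewrite exprVn exprS le_eqVlt; apply/orP; left; apply/eqP.
have : (2 ^+ j : R) != 0 by rewrite expf_neq0.
have : (j.+1%:R : R) != 0 by rewrite pnatr_eq0.
by move: (2 ^+ j) (j.+1%:R) => a b a0 b0; field; rewrite a0 b0.
Qed.

(** Bernoulli's inequality for the square root of [q] gives quadratic growth. *)
Lemma geometric_beats_linear (q M : R) : 1 < q -> exists k, M <= q ^+ k / k.+1%:R.
Proof.
move=> q1; pose s := Num.sqrt q - 1.
have q0 : 0 <= q by rewrite (le_trans ler01)// ltW.
have s0 : 0 < s by rewrite subr_gt0 -[ltLHS]sqrtr1 ltr_sqrt// (lt_trans ltr01).
have bernoulli k : k%:R * s <= Num.sqrt q ^+ k.
  suff : 1 + k%:R * s <= Num.sqrt q ^+ k by apply: le_trans; rewrite lerDr.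
  elim: k => [|k IH]; first by rewrite mul0r addr0.
  rewrite exprS (_ : Num.sqrt q = 1 + s); last by rewrite addrC subrK.
  rewrite (_ : Num.sqrt q = 1 + s) in IH; last by rewrite addrC subrK.
  have ks : 0 <= k%:R * s by rewrite mulr_ge0// ltW.
  apply: le_trans (ler_wpM2l _ IH); last by rewrite addr_ge0// ltW.
  rewrite -natr1; nra.
pose k := (Num.truncn (2 * M / s ^+ 2)).+1.
exists k; have k0 : 0 < k%:R :> R by rewrite ltr0n.
have kM : 2 * M <= k%:R * s ^+ 2.
  by rewrite -ler_pdivrMr ?exprn_gt0// ltW// truncnS_gt.
rewrite ler_pdivlMr// -[q](sqr_sqrtr q0) -exprM mulnC exprM.
have ks : (k%:R * s) ^+ 2 <= (Num.sqrt q ^+ k) ^+ 2.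
  by rewrite lerXn2r ?nnegrE ?mulr_ge0 ?exprn_ge0 ?sqrtr_ge0 ?(ltW s0).
apply: le_trans ks; rewrite -natr1.
have k1 : 1 <= k%:R :> R by rewrite ler1n.
move: k1 kM; move: (k%:R) => t t1 tM; rewrite exprMn.
have [M0|M0] := leP 0 M; last first.
  by apply: (@le_trans _ _ 0); [nra|rewrite mulr_ge0// exprn_ge0//; lra].
apply: (@le_trans _ _ (M * (2 * t))); first by rewrite ler_wpM2l//; lra.
rewrite mulrCA mulrA mulrC expr2 -mulrA ler_wpM2l//; lra.
Qed.

(** With [p > 2 d / (d - 2)] the p-th power of the last term of the sum, of order
    [2 ^ (k (d/2 - 1)) / k], outweighs the volume [2 ^ (- k d)]. *)
Lemma singular_sum_powR_unbounded (p M : R) : (2 < d)%N -> p_star R d < p ->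
  exists k, M <= singular_sum k `^ p / 2 ^+ (k * d).
Proof.
move=> d2 pd.
have dR2 : 2 < d%:R :> R by rewrite ltr_nat.
have dR0 : 0 < d%:R :> R by apply: lt_trans dR2.
have gap0 : 0 < 2^-1 - d%:R^-1 :> R by rewrite subr_gt0 ltf_pV2// posrE.
have p0 : 0 < p by rewrite (lt_trans _ pd)// invr_gt0.
have pgap : p^-1 < 2^-1 - d%:R^-1 by rewrite -[ltRHS]invrK ltf_pV2// posrE invr_gt0.
(* [b ^ k] is the [p]-th root of the volume [2 ^ (- k d)] *)
pose b : R := 2 `^ (- (d%:R / p)).
have b0 : 0 < b by rewrite powR_gt0.
pose q : R := Num.sqrt 2 ^+ d / 2 * b.
have q1 : 1 < q.
  have -> : q = 2 `^ (d%:R * 2^-1 - 1 - d%:R / p).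
    rewrite /q -powR12_sqrt// -powR_mulrn ?powR_ge0// -powRrM [2^-1 * _]mulrC.
    rewrite -[X in _ / X * _]powRr1// -powRB; last by rewrite pnatr_eq0 implybT.
    by rewrite -powRD// pnatr_eq0 implybT.
  have e0 : 0 < d%:R * 2^-1 - 1 - d%:R / p.
    have : d%:R * p^-1 < d%:R * (2^-1 - d%:R^-1) by rewrite ltr_pM2l.
    by rewrite mulrBr divff ?gt_eqF//; lra.
  by rewrite /powR pnatr_eq0 expR_gt1 mulr_gt0// ln_gt0// ltr1n.
have [k kq] := @geometric_beats_linear q ((`|M| `^ p^-1) * 2 / b) q1.
exists k.+1.
have volE : (2 ^+ (k.+1 * d))^-1 = (b ^+ k.+1) `^ p.
  rewrite -[in RHS]powR_mulrn ?(ltW b0)// -!powRrM -powR_mulrn// -powRN.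
  by congr (_ `^ _); rewrite natrM; field; rewrite gt_eqF.
rewrite volE -powRM ?singular_sum_ge0 ?exprn_ge0 ?(ltW b0)//.
apply: (@le_trans _ _ ((`|M| `^ p^-1) `^ p)).
  by rewrite -powRrM mulVf ?gt_eqF// powRr1// ler_norm.
rewrite ge0_ler_powR ?(ltW p0)// ?nnegrE ?powR_ge0 ?mulr_ge0 ?singular_sum_ge0 ?exprn_ge0 ?(ltW b0)//.
have Sk : height R d k * 2^-1 ^+ k.+1 <= singular_sum k.+1.
  by rewrite /singular_sum big_ord_recr/= lerDr singular_sum_ge0.
apply: le_trans (ler_wpM2r _ Sk); last by rewrite exprn_ge0// ltW.
have -> : height R d k * 2^-1 ^+ k.+1 * b ^+ k.+1 = q ^+ k / k.+1%:R * (b / 2).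
  rewrite /height /q mulnC exprM !exprMn !exprS.
  by ring.
have b2 : 0 <= b / 2 by rewrite divr_ge0// ltW.
apply: le_trans (ler_wpM2r b2 kq).
suff -> : `|M| `^ p^-1 * 2 / b * (b / 2) = `|M| `^ p^-1 by [].
by rewrite mulrA divfK ?gt_eqF// mulfK// pnatr_eq0.
Qed.

End growth.

(** * Norms forced to be infinite *)

Section blow_up.
Context d0 (T : measurableType d0) (R : realType) (mu : {measure set T -> \bar R}).

Lemma normc_nneg (z : R[i]) : 0 <= Normc.normc z.
Proof. by case: z => a b; exact: sqrtr_ge0. Qed.

Lemma Re_le_normc (z : R[i]) : complex.Re z <= Normc.normc z.
Proof.
case: z => a b /=; rewrite (le_trans (ler_norm a))// -sqrtr_sqr ler_wsqrtr//.
by rewrite lerDl sqr_ge0.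
Qed.

Lemma CLnorm_oo_eqy (Omega : set T) (g : T -> R[i]) (A : nat -> set T) (c : nat -> R) :
  (forall k, measurable (A k)) -> (forall k, A k `<=` Omega) ->
  (forall k, 0 < mu (A k))%E ->
  (forall k t, A k t -> c k <= Normc.normc (g t)) ->
  (forall M, exists k, M <= c k) ->
  CLnorm mu +oo Omega g = +oo%E.
Proof.
move=> mA AO A0 Ac cM; rewrite /CLnorm unlock.
set F := (X in ess_sup mu (abse \o X)).
have -> : (0 < mu setT)%E.
  by apply: lt_le_trans (A0 0%N) _; apply: le_measure; rewrite ?inE.
apply/eqyP => M M0; have [k Mk] := cM M.
rewrite leNgt; apply/negP => FM.
have [N [mN N0 subN]] := ess_sup_ge mu (abse \o F).
have : (mu (A k) <= mu N)%E.
  apply: le_measure; rewrite ?inE// => t At; apply: subN => /= /le_lt_trans/(_ FM).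
  rewrite /F patchE mem_set; last exact: AO At.
  rewrite gee0_abs ?lee_fin ?normc_nneg// lte_fin ltNge => /negP; apply.
  exact: le_trans Mk (Ac _ _ At).
by rewrite N0 leNgt A0.
Qed.

Lemma CLnorm_fin_eqy (p : R) (Omega : set T) (g : T -> R[i]) (A : nat -> set T)
    (c : nat -> R) : 0 < p ->
  (forall k, measurable (A k)) -> (forall k, A k `<=` Omega) ->
  (forall k, 0 <= c k) ->
  (forall k t, A k t -> c k <= Normc.normc (g t)) ->
  (forall M : R, exists k, (M%:E <= (c k `^ p)%:E * mu (A k))%E) ->
  CLnorm mu p%:E Omega g = +oo%E.
Proof.
move=> p0 mA AO c0 Ac cM; rewrite /CLnorm unlock.
apply: eqy_poweR; first by rewrite invr_gt0.
apply/eqyP => M M0; have [k Mk] := cM M; apply: (le_trans Mk).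
set F := (X in (\int[mu]_x `|X x| `^ p)%E).
have := @sum_le_integral _ _ R mu setT (fun x => (`|F x| `^ p)%E) 1
  (fun=> A k) (fun=> c k `^ p).
rewrite big_ord1; apply => //.
- by move=> x _; exact: poweR_ge0.
- by move=> i j _ _ _; rewrite !ord1.
- by move=> _; exact: powR_ge0.
move=> _ t At; rewrite /F patchE mem_set; last exact: AO At.
rewrite gee0_abs; last by rewrite lee_fin normc_nneg.
rewrite poweR_EFin lee_fin.
by rewrite ge0_ler_powR ?(ltW p0)// ?nnegrE ?normc_nneg// Ac.
Qed.

End blow_up.

(** * Completed Lebesgue measure on phase space *)

Section completed_lebesgue.
Context (R : realType) (d : nat).
Local Notation phase := ('rV[R]_d * 'rV[R]_d)%type.
Local Notation mu := (completed_lebesgue_phase R d).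
Local Notation T := (caratheodory_type ((lebesgue_phase R d)^*)%mu).

Lemma measurable_caratheodory (A : set phase) :
  measurable A -> measurable (A : set T).
Proof. by move=> mA; apply: sub_caratheodory; exact: sub_sigma_algebra. Qed.

Lemma measurable_fun_caratheodory d1 (U : measurableType d1) (X : phase -> U) :
  measurable_fun setT X -> measurable_fun [set: T] (X : T -> U).
Proof.
move=> mX _ Y mY; rewrite setTI; apply: measurable_caratheodory.
by rewrite -[_ @^-1` _]setTI; exact: mX.
Qed.

Lemma completed_lebesgue_phase_slice (x : 'rV[R]_d) : (0 < d)%N ->
  mu ([set z | z.1 = x] : set T) = 0%E.
Proof.
move=> d0; have -> : [set z : phase | z.1 = x] = [set x] `*` setT.
  by apply/seteqP; split=> -[a b] /=; [|case].
have mx : measurable ([set x] `*` [set: 'rV[R]_d]).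
  by apply: measurableX => //; exact: measurable_rV_set1.
transitivity (lebesgue_phase R d ([set x] `*` setT)).
  exact: (measurable_mu_extE (lebesgue_phase R d) mx).
rewrite /lebesgue_phase product_measure1E//; last exact: measurable_rV_set1.
by rewrite [X in (X * _)%E]lebesgue_rV_point// mul0e.
Qed.

End completed_lebesgue.

(** * Blow-up on a set of positive measure *)

Section packet_blow_up.
Context (R : realType) (d : nat).
Hypothesis d_ge2 : (2 <= d)%N.
Local Notation T := (caratheodory_type ((lebesgue_phase R d)^*)%mu).
Local Notation mu := (completed_lebesgue_phase R d).

(** The frequency variable is only localised, once, to a ball of fixed radius;
    the concentration argument is applied to the space variable alone. Hence the
    mass decays like [2^(- k d)], with only [d] of the [2 d] dimensions lost. *)
Lemma exists_phase_concentration (rho : R) (Omega : set T) : 0 < rho ->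
  measurable Omega -> (0 < mu Omega)%E ->
  exists (x0 xi0 : 'rV[R]_d) (m : \bar R) (A : nat -> set T),
  [/\ (0 < m)%E, forall k, measurable (A k), forall k, A k `<=` Omega,
    forall k, (m <= (2 ^+ (k * d))%:E * mu (A k))%E &
    forall k z, A k z -> [/\ z.1 != x0, supnorm (z.1 - x0) <= 2^-1 ^+ k &
      supnorm (z.2 - xi0) <= rho]].
Proof.
move=> rho_gt0 mO O0.
have mfst : measurable_fun [set: T] (fst : T -> 'rV[R]_d).
  by apply: measurable_fun_caratheodory; exact: measurable_fst.
have msnd : measurable_fun [set: T] (snd : T -> 'rV[R]_d).
  by apply: measurable_fun_caratheodory; exact: measurable_snd.
have mball (X : T -> 'rV[R]_d) x r : measurable_fun setT X ->
    measurable [set z | supnorm (X z - x) <= r].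
  move=> /(_ measurableT _ (measurable_supnorm_ball (- x) 1 r)).
  rewrite setTI; congr measurable; apply/seteqP; split => z /=;
    by rewrite scale1r addrC.
pose grid (b : 'rV[int]_d) : 'rV[R]_d := \row_i (rho * (b ord0 i)%:~R).
have [b Ob] : exists b, (0 < mu (Omega `&` [set z : T | (supnorm (z.2 - grid b) <= rho)%R]))%E.
  apply: measure_gt0_countable_cover => // [b|]; first exact: mball.
  apply/seteqP; split=> // z _; exists (\row_i Num.floor (z.2 ord0 i / rho)) => //=.
  apply/supnormP; first exact: ltW.
  move=> i; rewrite !mxE; have := floor_itv (z.2 ord0 i / rho).
  rewrite ler_pdivlMr// ltr_pdivrMr// intrD mulrDl mul1r => /andP[f1 f2].
  by rewrite ler_norml [rho * _]mulrC; apply/andP; split; lra.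
set xi0 := grid b in Ob; set E := Omega `&` _ in Ob.
have mE : measurable E by apply: measurableI => //; exact: mball.
pose corner (c : 'rV[int]_d) : 'rV[R]_d := \row_i (c ord0 i)%:~R.
have [c Ec] : exists c, (0 < mu (cell (fst : T -> 'rV[R]_d) E (corner c) 0))%E.
  pose unit c := [set z : T | forall i,
    (corner c ord0 i <= z.1 ord0 i < corner c ord0 i + 2^-1 ^+ 0)%R].
  apply: (@measure_gt0_countable_cover _ _ _ mu _ unit) => // [c|].
    rewrite -[unit c]setTI; exact: measurable_cell.
  apply/seteqP; split=> // z _; exists (\row_i Num.floor (z.1 ord0 i)) => //= i.
  by rewrite !mxE expr0 -intrD1 floor_itv.
have [x0 x0P] := exists_concentration_point mu mfst mE (corner c).
(* the lower bound for the packet fails on the null set [z.1 = x0] *)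
pose sing : set T := [set z | z.1 = x0].
have msing : measurable sing.
  rewrite -[sing]setTI; exact: (mfst measurableT _ (measurable_rV_set1 x0)).
have mB k : measurable (E `&` [set z : T | supnorm (z.1 - x0) <= 2^-1 ^+ k]).
  by apply: measurableI => //; exact: mball.
exists x0, xi0, (mu (cell (fst : T -> 'rV[R]_d) E (corner c) 0)),
  (fun k => (E `&` [set z : T | supnorm (z.1 - x0) <= 2^-1 ^+ k]) `\` sing).
split=> //.
- by move=> k; exact: measurableD.
- by move=> k z [[[]]].
- move=> k; rewrite measure_setD_null//.
  by apply: completed_lebesgue_phase_slice; rewrite (leq_trans _ d_ge2).
by move=> k z [[[_ z2] z1] zx0]; split => //; apply/eqP.
Qed.

Lemma exists_packet_blow_up (p : \bar R) (Omega : set T) :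
  (d = 2%N /\ p = +oo%E) \/ ((2 < d)%N /\ ((p_star R d)%:E < p)%E) ->
  measurable Omega -> (0 < mu Omega)%E ->
  exists x0 xi0 : 'rV[R]_d,
    CLnorm mu p Omega (born_jordan (packet x0 xi0)) = +oo%E.
Proof.
move=> hdp mO O0.
have rho_gt0 : 0 < (4 * pi * d%:R)^-1 :> R.
  by rewrite invr_gt0 !mulr_gt0// ?pi_gt0// ltr0n (leq_trans _ d_ge2).
have [x0 [xi0 [m [A [m0 mA AO Am AP]]]]] := exists_phase_concentration rho_gt0 mO O0.
exists x0, xi0.
pose c k : R := cos 1 * singular_sum R d k.
have c1 := @cos1_gt0 R.
have c0 k : 0 <= c k by rewrite mulr_ge0 ?singular_sum_ge0// ltW.
have Ac k z : A k z -> c k <= Normc.normc (born_jordan (packet x0 xi0) z).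
  move=> /AP[? ? ?]; apply: le_trans (Re_le_normc _).
  exact: Re_born_jordan_packet_ge.
case: p hdp => [p| |] hdp; last by case: hdp => -[].
- case: hdp => [[_ //]|[d2]]; rewrite lte_fin => pp.
  have dR2 : 2 < d%:R :> R by rewrite ltr_nat.
  have p0 : 0 < p.
    rewrite (lt_trans _ pp)// invr_gt0 subr_gt0 ltf_pV2// posrE//.
    by rewrite (lt_trans _ dR2).
  apply: (CLnorm_fin_eqy p0 mA AO c0 Ac) => M.
  have [m1 m10 m1m] : exists2 m1 : R, 0 < m1 & (m1%:E <= m)%E.
    case: m m0 {Am} => [r| |]// m0; first by exists r.
    by exists 1 => //; rewrite leey.
  have [k Mk] := @singular_sum_powR_unbounded R d p (`|M| / (cos 1 `^ p * m1)) d2 pp.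
  exists k; apply: (@le_trans _ _ ((c k `^ p / 2 ^+ (k * d))%:E * m)%E).
    apply: (@le_trans _ _ ((c k `^ p / 2 ^+ (k * d))%:E * m1%:E)%E); last first.
      by rewrite lee_wpmul2l// lee_fin divr_ge0 ?powR_ge0.
    rewrite -EFinM lee_fin /c powRM ?singular_sum_ge0 ?(ltW c1)//.
    have cm0 : 0 < cos 1 `^ p * m1 by rewrite mulr_gt0// powR_gt0.
    rewrite -!mulrA [_ * m1]mulrC [_ * (m1 * _)]mulrCA.
    move: Mk; rewrite ler_pdivrMr// => Mk; rewrite (le_trans (ler_norm M))//.
    by rewrite (le_trans Mk)// mulrC -!mulrA ler_wpM2l ?powR_ge0// mulrCA.
  have v0 : 0 < 2 ^+ (k * d) :> R by rewrite exprn_gt0.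
  apply: le_trans (lee_wpmul2l _ (Am k)) _; first by rewrite lee_fin divr_ge0 ?powR_ge0 ?(ltW v0).
  by rewrite muleA -EFinM divfK// gt_eqF.
apply: (CLnorm_oo_eqy mA AO _ Ac) => [k|M].
  have := lt_le_trans m0 (Am k); rewrite pmule_rgt0// lte_fin exprn_gt0//.
have [k Mk] := @singular_sum_unbounded R d d_ge2 (M / cos 1).
by exists k; rewrite /c mulrC -ler_pdivrMr.
Qed.

End packet_blow_up.

Theorem theorem1p7 (R : realType) (d : nat) (p : \bar R)
    (hdp : (d = 2%N /\ p = +oo%E) \/ ((2 < d)%N /\ ((p_star R d)%:E < p)%E))
    (Omega : set ('rV[R]_d * 'rV[R]_d))
    (mOmega : ((lebesgue_phase R d)^*)%mu.-cara.-measurable Omega)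
    (Omega_gt0 : (0 < completed_lebesgue_phase R d Omega)%E) :
  let ratio (f : 'rV[R]_d -> R[i]) : \bar R :=
    (CLnorm (completed_lebesgue_phase R d) p Omega (born_jordan f) /
     (CLnorm (lebesgue_rV R d) 2%:E setT f) ^+ 2)%E in
  (exists2 f, L2 R d f &
     ~ in_CLp (completed_lebesgue_phase R d) p Omega (born_jordan f)) /\
  (ereal_sup [set ratio f | f in L2_nonzero R d] = +oo%E /\
   exists2 f, L2_nonzero R d f & ratio f = +oo%E).
Proof.
have d_ge2 : (2 <= d)%N by case: hdp => [[->]|[/ltnW]].
have [x0 [xi0 blowup]] := exists_packet_blow_up d_ge2 hdp mOmega Omega_gt0.
have fL2 := packet_L2_nonzero d_ge2 x0 xi0.
move=> ratio.
have ratioE : ratio (packet x0 xi0) = +oo%E.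
  have fin := CLnorm_packet_lty d_ge2 x0 xi0.
  rewrite /ratio blowup; apply: gt0_mulye.
  have : (0 <= CLnorm (lebesgue_rV R d) 2%:E setT (packet x0 xi0))%E by exact: Lnorm_ge0.
  case: (CLnorm _ _ _ _) fin => // r _ r0.
  rewrite expe2 -EFinM inver; case: ifPn => // rr; rewrite lte_fin invr_gt0.
  by rewrite lt_neqAle eq_sym rr mulr_ge0.
split; first by exists (packet x0 xi0); [exact: fL2.1|case=> _ _; rewrite blowup].
split; last by exists (packet x0 xi0).
apply/eqP; rewrite -leye_eq; apply: ereal_sup_ubound.
by exists (packet x0 xi0).
Qed.
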